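(* Let $(V;\mathfrak f,\mathfrak g)$ be a dual-modular instance with density decomposition $V=S_1\cup\dots\cup S_k$ and component densities $\rho_1>\rho_2>\dots>\rho_k$. For a contract parameter $\alpha\in[0,1]$ let $\mathsf u_a(\alpha,S)=\alpha\,\mathfrak f(S)-\mathfrak g(S)$. Let $i$ be the largest index in $\{0,1,\dots,k\}$ such that $i=0$ or $\rho_i\ge \frac1\alpha$ (with $\frac10=+\infty$). Then $S_{\le i}:=\bigcup_{j=1}^i S_j$ (with $S_{\le 0}=\emptyset$) satisfies $S_{\le i}\in\arg\max_{S\subseteq V}\mathsf u_a(\alpha,S)$. Moreover, if $\rho_i>\frac1\alpha>\rho_{i+1}$, then $S_{\le i}$ is the unique maximizer of $\mathsf u_a(\alpha,\cdot)$. Consequently, the collection of critical values of smallest size is $\{\frac1{\rho_i}:1\le i\le k\}\cap[0,1]$.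
   Context: $V$ is a finite ground set. A dual-modular instance $(V;\mathfrak f,\mathfrak g)$ consists of $\mathfrak f,\mathfrak g:2^V\to\mathbb R_{\ge0}$ with $\mathfrak f(\emptyset)=\mathfrak g(\emptyset)=0$, $\mathfrak f$ monotone and supermodular, $\mathfrak g$ submodular and strictly monotone ($A\subsetneq B\Rightarrow\mathfrak g(A)<\mathfrak g(B)$). For $h:2^V\to\mathbb R$, $h(S\mid A):=h(S\cup A)-h(A)$. Density decomposition: $S_0=\emptyset$; for $i\ge1$, with $S_{<i}=\bigcup_{j<i}S_j$ and $V_i=V\setminus S_{<i}\neq\emptyset$, let $S_i$ be the (unique) inclusion-maximal subset of $V_i$ maximizing $\mathfrak f(S\mid S_{<i})/\mathfrak g(S\mid S_{<i})$ over nonempty $S\subseteq V_i$, and $\rho_i$ that maximum value; stop when $S_i=V_i$. Combinatorial contracts: for $\alpha\in[0,1]$ the agent picks a best response $S_\alpha\in\arg\max_S\mathsf u_a(\alpha,S)$, ties broken first in favor of the principal's utility $(1-\alpha)\mathfrak f(S)$ and then so that, as $\alpha$ increases from $0$ to $1$, $S_\alpha$ changes as infrequently as possible; the critical values are the values of $\alpha$ at which $S_\alpha$ changes.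
   Formalization: The critical-value claim fails as stated if some ρ_i = 1, since (1−α)f breaks no tie at α = 1; it is proved for all instances with ties left at α = 1 going to the larger f, and with the literal tie-breaking when no ρ_i equals 1. *)

(* Defs.v *)
From mathcomp Require Import all_boot all_order all_algebra.
From mathcomp Require Import all_classical all_reals all_analysis.

Set Implicit Arguments.
Unset Strict Implicit.
Unset Printing Implicit Defensive.

Import Order.TTheory GRing.Theory Num.Theory.
Import numFieldNormedType.Exports.

Local Open Scope ring_scope.

Section DualModular.
Context {R : realType} {V : finType}.
Implicit Types (f g h : {set V} -> R) (A B T : {set V}) (S : nat -> {set V}).

Definition monotone h := forall A B, A \subset B -> h A <= h B.

Definition strictly_monotone h := forall A B, A \proper B -> h A < h B.

Definition supermodular h :=
  forall A B, h A + h B <= h (A :|: B)%SET + h (A :&: B)%SET.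

Definition submodular h :=
  forall A B, h (A :|: B)%SET + h (A :&: B)%SET <= h A + h B.

Record dual_modular f g : Prop := DualModular {
  dm_f_ge0 : forall A, 0 <= f A;
  dm_g_ge0 : forall A, 0 <= g A;
  dm_f_empty : f finset.set0 = 0;
  dm_g_empty : g finset.set0 = 0;
  dm_f_monotone : monotone f;
  dm_f_supermodular : supermodular f;
  dm_g_submodular : submodular g;
  dm_g_strictly_monotone : strictly_monotone g }.

Definition marginal h T A : R := h (T :|: A)%SET - h A.

(* The denominator is positive when g is strictly monotone and T is nonempty
   and disjoint from A. *)
Definition density f g T A : R := marginal f T A / marginal g T A.

Definition candidate A T : bool :=
  (T != finset.set0) && (T \subset (~: A)%SET).

Definition densest f g A T : bool :=
  candidate A T &&
  [forall U : {set V}, candidate A U ==> (density f g U A <= density f g T A)].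

(* S_{<i} and S_{<=i} *)
Definition S_lt S (i : nat) : {set V} := (\bigcup_(j < i) S j)%SET.
Definition S_le S (i : nat) : {set V} := (\bigcup_(1 <= j < i.+1) S j)%SET.

Definition rho f g S (i : nat) : R := density f g (S i) (S_lt S i).

(* S_1, ..., S_k is the density decomposition; the values S j with j > k are
   irrelevant. [k = 0] only if V is empty. *)
Record density_decomposition f g (k : nat) S : Prop := DensityDecomposition {
  dd_zero : S 0%N = finset.set0;
  dd_continue : forall i, (1 <= i <= k)%N -> (~: S_lt S i)%SET != finset.set0;
  dd_component : forall i, (1 <= i <= k)%N ->
    maxset (densest f g (S_lt S i)) (S i);
  dd_stop : (~: S_lt S k.+1)%SET = finset.set0 }.

(* i = 0 or rho_i >= 1/a; the inverse is the one of \bar R, so 1/0 = +oo. *)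
Definition reaches f g S (a : R) (i : nat) : Prop :=
  i = 0%N \/ ((a%:E)^-1 <= (rho f g S i)%:E)%E.

Definition largest_reaching f g (k : nat) S (a : R) (i : nat) : Prop :=
  [/\ (i <= k)%N, reaches f g S a i &
      forall j, (j <= k)%N -> reaches f g S a j -> (j <= i)%N].

Definition u_a f g (a : R) A : R := a * f A - g A.
Definition u_p f (a : R) A : R := (1 - a) * f A.

Definition best_responses f g (a : R) : {set {set V}} :=
  [set A | [forall B : {set V}, u_a f g a B <= u_a f g a A]]%SET.

Definition principal_favored f g (a : R) : {set {set V}} :=
  [set A in best_responses f g a |
    [forall B in best_responses f g a, u_p f a B <= u_p f a A]]%SET.

(* At a = 1 the utility u_p vanishes identically, so that it breaks no tie.
   Here the ties left at a = 1 go to the larger value of f, which is what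
   maximizing u_p = (1 - a) f amounts to for every a < 1. *)
Definition principal_favored1 f g (a : R) : {set {set V}} :=
  [set A in principal_favored f g a |
    (a == 1) ==> [forall B in principal_favored f g a, f B <= f A]]%SET.

(* The points of [0, 1] near which r, restricted to [0, 1], is not constant. *)
Definition critical_values (r : R -> {set V}) : set R :=
  [set a : R | 0 <= a <= 1 /\
           ~ \forall b \near a, 0 <= b <= 1 -> r b = r a]%classic.

(* Selections from the favored best responses with fewest changes. *)
Definition agent_response (favored : R -> {set {set V}}) (r : R -> {set V}) :=
  let selection (s : R -> {set V}) :=
    forall a : R, 0 <= a <= 1 -> s a \in favored a in
  selection r /\
  forall s, selection s -> (critical_values r #<= critical_values s)%card.

Definition smallest_critical_values (favored : R -> {set {set V}})
    (C : set R) : Prop :=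
  exists r, agent_response favored r /\ C = critical_values r.

(* {1/rho_i : 1 <= i <= k} `&` [0, 1], where 1/0 = +oo. *)
Definition inverse_densities f g (k : nat) S : set R :=
  [set a : R | 0 <= a <= 1 /\
     exists2 i, (1 <= i <= k)%N & (a%:E = (rho f g S i)%:E^-1)%E]%classic.

End DualModular.

(* Main.v *)
(* For a >= 0 the agent's utility u = a f - g is supermodular. Given a set A, let
   T be the densest set to add to A, of density rho.
   - If a rho < 1, adding to A anything not contained in it lowers u.
   - If a rho >= 1, then u(A + T) >= u(A + U) for every subset U of T, and
     supermodularity gives u(C + A + T) >= u(C + A) for every C, strictly if
     a rho > 1 and C does not contain T.
   The densities decrease along the decomposition: if adding S_{i+1} were at
   least as dense as adding S_i, then the union of both would also be a densest
   choice at step i, against the maximality of S_i. Climbing along the prefixes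
   with a rho_j >= 1 therefore shows that the last one, A, is a best response
   containing every best response. Another best response with the same reward f
   would have the same cost g, so that A is the only favored best response.
   Hence the response is determined by the indices j with a rho_j >= 1, which
   change exactly at the values 1 / rho_j. *)
Require Import Defs.
From mathcomp Require Import all_boot all_order all_algebra.
From mathcomp Require Import all_classical all_reals all_analysis.
From mathcomp Require Import lra.

Import Order.TTheory GRing.Theory Num.Theory.
Import numFieldNormedType.Exports.

Local Open Scope ring_scope.

(** * Reciprocals in the extended reals *)

Lemma inve_le_fin (R : realType) (a x : R) : 0 <= a ->
  ((a%:E)^-1 <= x%:E)%E = (1 <= a * x).
Proof.
(* At [a = 0] the inverse is [+oo] and both sides are false. *)
rewrite le_eqVlt inver => /predU1P[<-|a0]; first by rewrite eqxx mul0r ler10.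
by rewrite gt_eqF// lee_fin -ler_pdivrMl// mulr1.
Qed.

Lemma inve_lt_fin (R : realType) (a x : R) : 0 <= a ->
  ((a%:E)^-1 < x%:E)%E = (1 < a * x).
Proof.
rewrite le_eqVlt inver => /predU1P[<-|a0]; first by rewrite eqxx mul0r ltr10.
by rewrite gt_eqF// lte_fin -ltr_pdivrMl// mulr1.
Qed.

Lemma fin_eq_inve (R : realType) (a x : R) : (a%:E = (x%:E)^-1)%E <-> a * x = 1.
Proof.
rewrite inver; have [->|x0] := eqVneq x 0.
  by rewrite mulr0; split=> // /esym/eqP; rewrite oner_eq0.
split=> [[->]|ax]; first by rewrite mulVf.
by congr (_%:E); apply: (mulIf x0); rewrite mulVf.
Qed.

(** * Adding a densest set to a given set *)

Section Densest.
Set Implicit Arguments.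
Unset Strict Implicit.
Context {R : realType} {V : finType}.
Implicit Types (a : R) (f g : {set V} -> R) (A B T U : {set V}).

Lemma u_a_marginal f g a U A :
  u_a f g a (U :|: A)%SET =
  u_a f g a A + (a * marginal f U A - marginal g U A).
Proof. by rewrite /u_a /marginal; lra. Qed.

Lemma marginal_set0 f A : marginal f finset.set0 A = 0.
Proof. by rewrite /marginal finset.set0U subrr. Qed.

Lemma marginalU f U T A :
  marginal f (T :|: U)%SET A = marginal f T A + marginal f U (A :|: T)%SET.
Proof.
rewrite /marginal (finset.setUC T U) -finset.setUA (finset.setUC T A); lra.
Qed.

Lemma marginal_gt0 g A U : strictly_monotone g -> candidate A U ->
  0 < marginal g U A.
Proof.
move=> gS /andP[/finset.set0Pn[x xU] UA]; rewrite subr_gt0; apply: gS.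
apply/properP; split; first exact: finset.subsetUr.
exists x; first by rewrite inE xU.
by have := fintype.subsetP UA _ xU; rewrite inE.
Qed.

Lemma densest_marginal f g A T U : strictly_monotone g ->
  densest f g A T -> U \subset (~: A)%SET ->
  marginal f U A <= density f g T A * marginal g U A.
Proof.
move=> gS /andP[_ /forallP TU] UA.
have [->|U0] := eqVneq U finset.set0; first by rewrite !marginal_set0 mulr0.
have cU : candidate A U by rewrite /candidate U0.
by have := implyP (TU U) cU; rewrite ler_pdivrMr// marginal_gt0.
Qed.

Lemma candidate_marginal f g A T : strictly_monotone g -> candidate A T ->
  marginal f T A = density f g T A * marginal g T A.
Proof. by move=> gS cT; rewrite divfK// gt_eqF// marginal_gt0. Qed.

Lemma u_a_supermodular f g a : dual_modular f g -> 0 <= a ->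
  supermodular (u_a f g a).
Proof.
move=> [_ _ _ _ _ fsup gsub _] a0 A B.
have := ler_wpM2l a0 (fsup A B); have := gsub A B; rewrite /u_a !mulrDr; lra.
Qed.

Lemma u_a_above_densest f g a A T B : dual_modular f g -> 0 <= a ->
  densest f g A T -> a * density f g T A < 1 -> ~~ (B \subset A) ->
  u_a f g a (B :|: A)%SET < u_a f g a A.
Proof.
move=> fg a0 dT aT BA.
have gS := dm_g_strictly_monotone fg.
have -> : (B :|: A = (B :\: A) :|: A)%SET.
  by apply/finset.setP=> x; rewrite !inE; case: (x \in A); rewrite ?orbT ?orbF.
have cB : candidate A (B :\: A)%SET.
  by rewrite /candidate finset.setD_eq0 BA; apply/fintype.subsetP=> x;
     rewrite !inE => /andP[].
rewrite u_a_marginal; set U := (B :\: A)%SET in cB *.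
have gU := marginal_gt0 gS cB.
have := ler_wpM2l a0 (densest_marginal gS dT (proj2 (andP cB))).
rewrite mulrA; have : a * density f g T A * marginal g U A < marginal g U A.
  by rewrite gtr_pMl.
lra.
Qed.

(* Supermodularity of [u_a] reduces the step to the subset
   [(C :|: A) :&: (A :|: T)] of [A :|: T]. *)
Lemma u_a_add_densest f g a A T C : dual_modular f g -> 0 <= a ->
  densest f g A T ->
  let u := u_a f g a in
  (1 <= a * density f g T A -> u (C :|: A)%SET <= u (C :|: (A :|: T))%SET) /\
  (1 < a * density f g T A -> ~~ (T \subset C) ->
    u (C :|: A)%SET < u (C :|: (A :|: T))%SET).
Proof.
move=> fg a0 dT u.
have gS := dm_g_strictly_monotone fg.
have cT : candidate A T by case/andP: dT.
have := u_a_supermodular fg a0 (C :|: A)%SET (A :|: T)%SET.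
have -> : ((C :|: A) :|: (A :|: T) = C :|: (A :|: T))%SET.
  by rewrite -finset.setUA (finset.setUA A A) finset.setUid.
have -> : ((C :|: A) :&: (A :|: T) = (C :&: T) :|: A)%SET.
  by rewrite (finset.setUC A T) -finset.setUIl.
rewrite -/u => sup.
have TA := proj2 (andP cT).
have UA : (C :&: T)%SET \subset (~: A)%SET.
  exact: fintype.subset_trans (finset.subsetIr _ _) TA.
have hU := ler_wpM2l a0 (densest_marginal gS dT UA).
have hT := congr1 ( *%R a) (candidate_marginal f gS cT).
have uU := u_a_marginal f g a (C :&: T)%SET A.
have := u_a_marginal f g a T A; rewrite (finset.setUC T A) => uT.
rewrite -/u mulrA in uU uT hU hT.
have CT : ((C :&: T) :|: A)%SET \subset (T :|: A)%SET.
  by apply: finset.setSU; exact: finset.subsetIr.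
have mgE : marginal g T A - marginal g (C :&: T)%SET A =
    g (T :|: A)%SET - g ((C :&: T) :|: A)%SET.
  by rewrite /marginal; lra.
move: (density f g T A) (marginal g T A) (marginal f T A)
  (marginal g _ A) (marginal f _ A) hU hT uU uT mgE
  => d gT fT gU fU hU hT uU uT mgE.
split=> [d1|d1 TC].
  (* Since [a * fT = a * d * gT] and [a * fU <= a * d * gU], passing from [(C :&: T) :|: A] to
     [T :|: A] raises [u] by at least this product. *)
  have : 0 <= (a * d - 1) * (gT - gU).
    apply: mulr_ge0; first by rewrite subr_ge0.
    rewrite mgE subr_ge0.
    by move: CT; rewrite finset.subEproper => /predU1P[->//|/gS/ltW].
  lra.
have : 0 < (a * d - 1) * (gT - gU).
  apply: mulr_gt0; first by rewrite subr_gt0.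
  rewrite mgE subr_gt0; apply: gS; rewrite fintype.properE CT/=.
  apply: contra TC => /fintype.subsetP TC; apply/fintype.subsetP=> x xT.
  have := TC x; rewrite !inE xT => /(_ isT).
  have := fintype.subsetP TA x xT; rewrite inE => /negbTE ->.
  by rewrite orbF andbT.
lra.
Qed.

End Densest.

(** * Prefixes of the decomposition and their densities *)

Section Decomposition.
Set Implicit Arguments.
Unset Strict Implicit.
Context {R : realType} {V : finType} {f g : {set V} -> R} {k : nat}.
Context {S : nat -> {set V}}.
Hypothesis fg : dual_modular f g.
Hypothesis dec : density_decomposition f g k S.
Implicit Types (a b : R) (B C : {set V}) (i j : nat).

Local Notation rho := (rho f g S).
Local Notation u_a := (u_a f g).

Let gS := dm_g_strictly_monotone fg.

Lemma S_leE i : S_le S i = S_lt S i.+1.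
Proof.
rewrite /S_lt -(big_mkord xpredT S) big_ltn// (dd_zero dec).
by rewrite finset.set0U.
Qed.

Lemma S_le0 : S_le S 0 = finset.set0.
Proof. by rewrite /S_le big_geq. Qed.

Lemma S_leS i : S_le S i.+1 = (S_le S i :|: S i.+1)%SET.
Proof. by rewrite /S_le big_nat_recr. Qed.

Lemma S_le_last : S_le S k = [set: V]%SET.
Proof.
rewrite S_leE -[LHS]finset.setCK (dd_stop dec).
by apply/finset.setP=> x; rewrite !inE.
Qed.

Lemma rhoE i : rho i.+1 = density f g (S i.+1) (S_le S i).
Proof. by rewrite S_leE. Qed.

Lemma component_maxset i : (i < k)%N ->
  maxset (densest f g (S_le S i)) (S i.+1).
Proof. by move=> ik; rewrite S_leE; apply: (dd_component dec); rewrite ltnS. Qed.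

Lemma component_densest i : (i < k)%N -> densest f g (S_le S i) (S i.+1).
Proof. by move/component_maxset/maxsetp. Qed.

Lemma component_candidate i : (i < k)%N -> candidate (S_le S i) (S i.+1).
Proof. by move/component_densest/andP=> []. Qed.

Lemma S_le_proper i j : (i < j)%N -> (j <= k)%N ->
  (S_le S i \proper S_le S j)%SET.
Proof.
elim: j => // j IH; rewrite ltnS leq_eqVlt => ij jk.
have step : S_le S j \proper S_le S j.+1.
  have /andP[/finset.set0Pn[x xS] SC] := component_candidate jk.
  rewrite S_leS; apply/properP; split; first exact: finset.subsetUl.
  exists x; first by rewrite inE xS orbT.
  by have := fintype.subsetP SC _ xS; rewrite inE.
case/predU1P: ij => [->//|ij].
by apply: fintype.proper_trans step; apply: IH => //; exact: ltnW.
Qed.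

Lemma rho_decreasing i : (i.+1 < k)%N -> rho i.+2 < rho i.+1.
Proof.
move=> ik; have ik' := ltnW ik; rewrite !rhoE ltNge; apply/negP => le_rho.
have /maxsetP[dT maxT] := component_maxset ik'.
have cT := component_candidate ik'.
have cT' := component_candidate ik.
have [T'0 T'A] := andP cT'; have [T0 TA] := andP cT.
have AT : S_le S i.+1 = (S_le S i :|: S i.+1)%SET by rewrite S_leS.
have cU : candidate (S_le S i) (S i.+1 :|: S i.+2)%SET.
  rewrite /candidate finset.setU_eq0 (negbTE T0)/= finset.subUset TA/=.
  apply: (fintype.subset_trans T'A); rewrite finset.setCS AT.
  exact: finset.subsetUl.
have dU : densest f g (S_le S i) (S i.+1 :|: S i.+2)%SET.
  rewrite /densest cU; apply/forallP => W; apply/implyP => cW.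
  have /andP[_ /forallP/(_ W)/implyP/(_ cW) le_W] := dT.
  (* The marginals of the union split into those of its two components, so its density is a mediant
     of theirs, and neither is below that of [S i.+1]. *)
  apply: (le_trans le_W); rewrite [leRHS]/density ler_pdivlMr ?marginal_gt0//.
  rewrite !marginalU -AT (candidate_marginal f gS cT).
  rewrite (candidate_marginal f gS cT') mulrDr lerD2l ler_pM2r//.
  exact: marginal_gt0.
(* Maximality puts [S i.+2] inside [S i.+1], although it is nonempty and disjoint from it. *)
have TU : S i.+1 = (S i.+1 :|: S i.+2)%SET.
  by rewrite -{1}(maxT _ dU (finset.subsetUl _ _)).
have /finset.set0Pn[x xT'] := T'0.
have := fintype.subsetP T'A x xT'; rewrite AT 2!inE TU !inE xT'.
by rewrite !orbT.
Qed.

Lemma rho_antitone i j : (1 <= j <= i)%N -> (i <= k)%N -> rho i <= rho j.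
Proof.
case/andP; case: j => // j _; elim: i => // i IH.
rewrite ltnS leq_eqVlt => /predU1P[->//|ji] ik.
apply: le_trans (IH ji (ltnW ik)).
by case: i ji ik {IH} => // i _ ik; exact/ltW/rho_decreasing.
Qed.

(** Only the components up to [i] and the next one are constrained. The products avoid a case
    distinction at [a = 0]. *)
Definition level a i := [/\ (i <= k)%N,
  forall j, (1 <= j <= i)%N -> 1 <= a * rho j &
  (i < k)%N -> a * rho i.+1 < 1].

(** * Best responses at a given level *)

Lemma u_a_S_le a i C : 0 <= a -> (i <= k)%N ->
  (forall j, (1 <= j <= i)%N -> 1 <= a * rho j) ->
  u_a a C <= u_a a (C :|: S_le S i)%SET.
Proof.
move=> a0; elim: i => [|i IH] ik lev; first by rewrite S_le0 finset.setU0.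
apply: (le_trans (IH (ltnW ik) _)).
  by move=> j /andP[j0 ji]; apply: lev; rewrite j0 ltnW.
rewrite S_leS; apply: (u_a_add_densest C fg a0 (component_densest ik)).1.
by rewrite -rhoE; apply: lev; rewrite ltnSn.
Qed.

Lemma u_a_S_le_lt a i C : 0 <= a -> (i <= k)%N ->
  (forall j, (1 <= j <= i)%N -> 1 < a * rho j) ->
  ~~ (S_le S i \subset C) -> u_a a C < u_a a (C :|: S_le S i)%SET.
Proof.
move=> a0; elim: i => [|i IH] ik lev; first by rewrite S_le0 finset.sub0set.
have lev' j : (1 <= j <= i)%N -> 1 < a * rho j.
  by move=> /andP[j0 ji]; apply: lev; rewrite j0 ltnW.
have [le1 lt1] := u_a_add_densest C fg a0 (component_densest ik).
have ri : 1 < a * rho i.+1 by apply: lev; rewrite ltnSn.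
(* If [C] contains the shorter prefix, it misses part of the last component and the last step gains
   strictly; otherwise the earlier steps already do. *)
rewrite S_leS finset.subUset; have [iC /= SC|iC _] := boolP (S_le S i \subset C).
  by rewrite -{1}(finset.setUidPl iC); apply: lt1; rewrite -?rhoE.
apply: (lt_le_trans (IH (ltnW ik) lev' iC)).
by apply: le1; rewrite -rhoE ltW.
Qed.

Lemma u_a_above_level a i B : 0 <= a -> level a i ->
  ~~ (B \subset S_le S i) -> u_a a (B :|: S_le S i)%SET < u_a a (S_le S i).
Proof.
move=> a0 [ik _ lt1] BS.
move: ik; rewrite leq_eqVlt => /predU1P[iE|ik].
  by rewrite iE S_le_last finset.subsetT in BS.
by apply: u_a_above_densest (component_densest ik) _ BS; rewrite // -rhoE lt1.
Qed.

Lemma u_a_setU_level a i B : 0 <= a -> level a i ->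
  u_a a (B :|: S_le S i)%SET <= u_a a (S_le S i).
Proof.
move=> a0 lev; have [BS|BS] := boolP (B \subset S_le S i).
  by rewrite finset.setUC (finset.setUidPl BS).
exact/ltW/u_a_above_level.
Qed.

Lemma level_best a i : 0 <= a -> level a i ->
  S_le S i \in best_responses f g a.
Proof.
move=> a0 lev; rewrite inE; apply/forallP => B; have [ik le1 _] := lev.
exact: le_trans (u_a_S_le _ a0 ik le1) (u_a_setU_level _ a0 lev).
Qed.

(** If [B] left the prefix, joining the prefix to [B] would not lower the utility, and dropping the
    rest of [B] would then raise it strictly. *)
Lemma best_sub_level a i B : 0 <= a -> level a i ->
  B \in best_responses f g a -> B \subset S_le S i.
Proof.
move=> a0 lev; rewrite inE => /forallP/(_ (S_le S i)).
apply: contraLR => BS; rewrite -ltNge; have [ik le1 _] := lev.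
exact: le_lt_trans (u_a_S_le _ a0 ik le1) (u_a_above_level a0 lev BS).
Qed.

Lemma level_best_unique a i : 0 <= a -> level a i ->
  (forall j, (1 <= j <= i)%N -> 1 < a * rho j) ->
  best_responses f g a = [set S_le S i]%SET.
Proof.
move=> a0 lev lt1; apply/finset.setP => B; rewrite [RHS]inE.
apply/idP/eqP => [BB|->]; last exact: level_best.
have BS := best_sub_level a0 lev BB.
apply/eqP; rewrite finset.eqEsubset BS/=.
move: BB; rewrite inE => /forallP/(_ (S_le S i)).
apply: contraLR => SB; rewrite -ltNge; have [ik _ _] := lev.
exact: lt_le_trans (u_a_S_le_lt a0 ik lt1 SB) (u_a_setU_level _ a0 lev).
Qed.

(** A best response lies inside the prefix. A proper subset with the same reward would be strictly
    cheaper, so the prefix would not be best. *)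
Lemma best_reward_level a i B : 0 <= a -> level a i ->
  B \in best_responses f g a -> f (S_le S i) <= f B -> B = S_le S i.
Proof.
move=> a0 lev BB fB; have BS := best_sub_level a0 lev BB.
apply/eqP; move: BS; rewrite finset.subEproper => /orP[//|BS].
have fE : f B = f (S_le S i).
  by apply/le_anti; rewrite fB (dm_f_monotone fg) ?fintype.proper_sub.
have := gS BS; have := level_best a0 lev; rewrite inE => /forallP/(_ B).
by rewrite /Defs.u_a fE lerD2l lerN2 leNgt => /negbTE ->.
Qed.

Lemma level_favored a i : 0 <= a <= 1 -> level a i ->
  S_le S i \in principal_favored f g a.
Proof.
move=> /andP[a0 a1] lev; rewrite inE level_best//=.
apply/forallP => B; apply/implyP => BB; rewrite ler_wpM2l ?subr_ge0//.
exact/(dm_f_monotone fg)/(best_sub_level a0 lev).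
Qed.

Lemma principal_favored1_level a i : 0 <= a <= 1 -> level a i ->
  principal_favored1 f g a = [set S_le S i]%SET.
Proof.
move=> a01 lev; have /andP[a0 a1] := a01; apply/finset.setP => B.
have SF := level_favored a01 lev.
rewrite [RHS]inE [LHS]inE; apply/andP/eqP => [[BF tie]|->].
  have BB : B \in best_responses f g a by move: BF; rewrite inE => /andP[].
  apply: (best_reward_level a0 lev BB).
  (* The rewards are compared by the explicit tie-break at [a = 1], and by cancelling [1 - a > 0] in
     [u_p] otherwise. *)
  have [aE|aE] := eqVneq a 1.
    by move: tie; rewrite aE eqxx -aE => /forallP/(_ (S_le S i))/implyP/(_ SF).
  move: BF; rewrite inE => /andP[_ /forallP/(_ (S_le S i))/implyP].
  by move/(_ (level_best a0 lev)); rewrite ler_pM2l// subr_gt0 lt_neqAle aE.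
split=> //; apply/implyP => _; apply/forallP => B'; apply/implyP => B'F.
apply/(dm_f_monotone fg)/(best_sub_level a0 lev).
by move: B'F; rewrite inE => /andP[].
Qed.

(** At [a = 1] the principal breaks no tie, but excluding density 1 makes every inequality of the
    level strict, so the best response is already unique. *)
Lemma principal_favored_level a i : 0 <= a <= 1 -> level a i ->
  (forall j, (1 <= j <= k)%N -> rho j != 1) ->
  principal_favored f g a = [set S_le S i]%SET.
Proof.
move=> a01 lev rho1; have [aE|aE] := eqVneq a 1; last first.
  by rewrite -(principal_favored1_level a01 lev); apply/finset.setP => B;
     rewrite [RHS]inE (negbTE aE) andbT.
have [ik le1 _] := lev; have a0 : 0 <= a by case/andP: a01.
apply/finset.setP => B; apply/idP/idP => [|].
  rewrite -(level_best_unique a0 lev); first by rewrite inE => /andP[].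
  move=> j /andP[j0 ji]; have := le1 j; rewrite j0 ji => /(_ isT).
  by rewrite aE mul1r lt_neqAle eq_sym rho1// j0 (leq_trans ji).
by rewrite inE => /eqP ->; exact: level_favored.
Qed.

(** Position [j] stands for component [j.+1], so [find] counts the components before the first one
    failing the test, and returns [k] if none fails. *)
Definition level_index a : nat :=
  find (fun j => a * rho j.+1 < 1) (iota 0 k).

Lemma level_indexP a : level a (level_index a).
Proof.
have le_k : (level_index a <= k)%N.
  by rewrite -[X in (_ <= X)%N](size_iota 0 k); exact: find_size.
split=> // [[//|j] /andP[_ ji]|ik].
  have := before_find 0%N ji; rewrite nth_iota ?add0n; last exact: leq_trans le_k.
  by move/negbT; rewrite -leNgt.
have := ik; rewrite -[X in (_ < X)%N](size_iota 0 k) -has_find => /(nth_find 0%N).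
by rewrite nth_iota.
Qed.

(** Antitone densities turn the single condition at [i] into one for all earlier components. *)
Lemma level_largest_reaching a i : 0 <= a ->
  largest_reaching f g k S a i -> level a i.
Proof.
move=> a0 [ik ri maxi]; split=> // [j /andP[j0 ji]|i_lt_k].
  case: ri => [i0|]; first by rewrite i0 leqNgt j0 in ji.
  rewrite inve_le_fin// => /le_trans; apply; rewrite ler_wpM2l//.
  by apply: rho_antitone; rewrite ?j0.
rewrite ltNge; apply/negP => ri'.
suff: (i < i)%N by rewrite ltnn.
by apply: maxi => //; right; rewrite inve_le_fin.
Qed.

(** * Jumps of the level and critical values *)

Lemma level_index_left a b i : (1 <= i <= k)%N -> a * rho i = 1 ->
  0 <= b < a -> (level_index b < level_index a)%N.
Proof.
move=> /andP[i0 ik] ai /andP[b0 ba]; have a0 := le_lt_trans b0 ba.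
have ri : 0 < rho i by rewrite -(pmulr_rgt0 _ a0) ai.
have [_ le1 _] := level_indexP b; have [jk _ lt1] := level_indexP a.
apply: (@leq_trans i).
  (* The index [i] separates the two levels: [b * rho i < 1] keeps that of [b] below [i], and
     [a * rho i = 1] lifts that of [a] to at least [i]. *)
  rewrite ltnNge; apply/negP => ij.
  have := le1 i; rewrite i0 ij => /(_ isT).
  by rewrite leNgt -ai ltr_pM2r// ba.
rewrite leqNgt; apply/negP => ij.
have j_lt_k := leq_trans ij ik; have := lt1 j_lt_k.
rewrite ltNge -ai ler_wpM2l ?(ltW a0)//.
by apply: rho_antitone; rewrite ?ij.
Qed.

(** The level depends on finitely many comparisons with 1, each strict at [a] and hence stable
    nearby by continuity. *)
Lemma level_index_near a : (forall i, (1 <= i <= k)%N -> a * rho i != 1) ->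
  \forall b \near a, level_index b = level_index a.
Proof.
move=> nea.
have : \forall b \near a, forall j : 'I_k,
    (b * rho j.+1 < 1) = (a * rho j.+1 < 1).
  apply: (filter_forall (nbhs_filter a)) => j.
  have cvg_a : (x * rho j.+1 @[x --> a] --> a * rho j.+1)%classic.
    exact: mulrr_continuous.
  have [lt1|gt1|/eqP] := ltgtP (a * rho j.+1) 1.
  - by apply: filterS (cvgr_lt _ cvg_a _ lt1).
  - by apply: filterS (cvgr_gt _ cvg_a _ gt1) => b /lt_gtF.
  - by rewrite (negbTE (nea _ _))//; case: j {cvg_a}.
apply: filterS => b ba; apply: eq_in_find => j; rewrite mem_iota /= => jk.
exact: (ba (Ordinal jk)).
Qed.

Lemma critical_values_level (r : R -> {set V}) :
  (forall a, 0 <= a <= 1 -> r a = S_le S (level_index a)) ->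
  critical_values r = inverse_densities f g k S.
Proof.
move=> rE; apply/seteqP; split=> a [a01 ca]; split=> //.
  apply: contrapT => noi; apply: ca.
  have /level_index_near : forall i, (1 <= i <= k)%N -> a * rho i != 1.
    move=> i ik; apply/eqP => ai; apply: noi; exists i => //.
    exact/fin_eq_inve.
  by apply: filterS => b ba b01; rewrite !rE// ba.
have [i ik /fin_eq_inve ai] := ca => near_a.
have /andP[a0 a1] := a01.
have {}a0 : 0 < a.
  by rewrite lt_neqAle a0 andbT; apply: contra_eqN ai => /eqP <-;
     rewrite mul0r eq_sym oner_eq0.
(* A component counts as reached at equality, so the jump shows on the left of [a], where points
   close to [a] stay in [[0, 1]] even for [a = 1]. *)
have near_al : (\forall b \near a^'-, 0 <= b <= 1 -> r b = r a)%classic.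
  exact: cvg_within near_a.
have [b [[rb b0] ba]] := filter_ex (filterI (filterI near_al (nbhs_left_gt a0))
  (nbhs_left_lt a)).
have b01 : 0 <= b <= 1 by rewrite !ltW// (lt_le_trans ba).
have [jk _ _] := level_indexP a.
have lt_ba : 0 <= b < a by rewrite ltW.
have := S_le_proper (level_index_left ik ai lt_ba) jk.
by rewrite -!rE// rb// fintype.properxx.
Qed.

(** With a single favored response everywhere, all selections agree on [[0, 1]] and have the same
    critical values, so each has the fewest. *)
Lemma smallest_critical_values_level (favored : R -> {set {set V}}) :
  (forall a, 0 <= a <= 1 -> favored a = [set S_le S (level_index a)]%SET) ->
  forall C : set R,
    smallest_critical_values favored C <-> C = inverse_densities f g k S.
Proof.
move=> favE C.
have selE (s : R -> {set V}) : (forall a, 0 <= a <= 1 -> s a \in favored a) ->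
    forall a, 0 <= a <= 1 -> s a = S_le S (level_index a).
  by move=> sel a a01; apply/finset.set1P; rewrite -favE// sel.
split=> [[r [[/selE rE _] ->]]|->]; first exact: critical_values_level.
exists (fun a => S_le S (level_index a)); split; last first.
  by rewrite critical_values_level.
split=> [a a01|s /selE sE]; first by rewrite favE// finset.set11.
by rewrite !critical_values_level.
Qed.

End Decomposition.

Theorem theorem1p2 (R : realType) (V : finType) (f g : {set V} -> R)
    (k : nat) (S : nat -> {set V})
    (fg : dual_modular f g) (dec : density_decomposition f g k S) :
  [/\ forall (a : R) (i : nat), 0 <= a <= 1 ->
        largest_reaching f g k S a i ->
        S_le S i \in best_responses f g a /\
        ((i = 0%N \/ ((a%:E)^-1 < (rho f g S i)%:E)%E) ->
         (i = k \/ ((rho f g S i.+1)%:E < (a%:E)^-1)%E) ->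
         best_responses f g a = [set S_le S i]%SET),
      forall C : set R,
        smallest_critical_values (principal_favored1 f g) C <->
        C = inverse_densities f g k S
    & (forall i, (1 <= i <= k)%N -> rho f g S i != 1) ->
      forall C : set R,
        smallest_critical_values (principal_favored f g) C <->
        C = inverse_densities f g k S].
Proof.
split=> [a i /andP[a0 _] reach||rho1].
- have lev := level_largest_reaching fg dec a0 reach.
  split=> [|strict _]; first exact: (level_best fg dec a0 lev).
  apply: (level_best_unique fg dec a0 lev) => j /andP[j0 ji].
  case: strict => [i0|]; first by rewrite i0 leqNgt j0 in ji.
  rewrite inve_lt_fin// => /lt_le_trans; apply; rewrite ler_wpM2l//.
  by case: reach => ik _ _; apply: (rho_antitone fg dec); rewrite ?j0.
- apply: (smallest_critical_values_level fg dec) => a a01.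
  exact: (principal_favored1_level fg dec a01 (level_indexP a)).
- apply: (smallest_critical_values_level fg dec) => a a01.
  exact: (principal_favored_level fg dec a01 (level_indexP a)).
Qed.
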